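(* Let $h\ge 1$ be an integer and let $G=(V,E)$ be an undirected graph with non-negative edge weights that is $K_h$-minor-free. Let $S=\langle s_0,s_1,\ldots,s_{k-1}\rangle$ be any sequence of vertices of $G$ and let $M\subseteq\mathbb{R}$ be any set of real numbers. For each $v\in V$ define $$\widehat{X}_v=\{(i,\Delta): 1\le i\le k-1,\ \Delta\in M,\ d_G(v,s_i)-d_G(v,s_0)\le \Delta\},$$ and let $\widehat{\mathcal{LP}}_{G,M}(S)=\{\widehat{X}_v: v\in V\}$, a family of subsets of the ground set $\{1,\ldots,k-1\}\times M$. Then $\widehat{\mathcal{LP}}_{G,M}(S)$ has VC-dimension at most $h-1$.
   Context: $d_G(u,v)$ denotes the shortest-path distance in $G$. For a family $\mathcal{F}$ of subsets of a ground set $U$, a set $Y\subseteq U$ is shattered by $\mathcal{F}$ if $\{Y\cap F: F\in\mathcal{F}\}=2^Y$; the VC-dimension of $\mathcal{F}$ is the maximum size of a shattered set. *)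

(* Defs.v *)
From HB Require Import structures.
From mathcomp Require Import all_boot all_order all_algebra.
From mathcomp Require Import all_classical all_reals all_analysis.
Set Implicit Arguments.
Unset Strict Implicit.
Unset Printing Implicit Defensive.
Import Order.TTheory GRing.Theory Num.Theory.
Local Open Scope classical_set_scope.
Local Open Scope ring_scope.

Record sgraph (V : finType) := SGraph {
  edge : rel V;
  edge_sym : symmetric edge;
  edge_irr : irreflexive edge }.

Definition connected_in (V : finType) (G : sgraph V) (B : {set V}) : Prop :=
  (exists x, x \in B) /\
  (forall x y, x \in B -> y \in B ->
     connect [rel u v | [&& u \in B, v \in B & edge G u v]] x y).

(* The sets B i are the branch sets of a model of H in G. *)
Definition is_minor (W V : finType) (H : sgraph W) (G : sgraph V) : Prop :=
  exists B : W -> {set V},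
    [/\ forall i, connected_in G (B i),
        forall i j x, x \in B i -> x \in B j -> i = j &
        forall i j, edge H i j ->
          exists x y, [/\ x \in B i, y \in B j & edge G x y]].

Lemma complete_sym h : symmetric [rel i j : 'I_h | i != j].
Proof. by move=> i j; rewrite /= eq_sym. Qed.

Lemma complete_irr h : irreflexive [rel i j : 'I_h | i != j].
Proof. by move=> i; rewrite /= eqxx. Qed.

Definition complete_graph (h : nat) : sgraph 'I_h :=
  SGraph (@complete_sym h) (@complete_irr h).

Definition path_length (R : realType) (V : finType) (w : V -> V -> R)
    (u : V) (p : seq V) : R := \sum_(x <- pairmap w u p) x.

(* The path u :: p visits each vertex at most once, so the infimum is over
   finitely many values; it is +oo when no path joins u to v. *)
Definition dist (R : realType) (V : finType) (G : sgraph V)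
    (w : V -> V -> R) (u v : V) : \bar R :=
  ereal_inf [set (path_length w u p)%:E |
    p in [set p : seq V |
           [/\ path (edge G) u p, uniq (u :: p) & last u p = v]]].

Definition shattered (T : Type) (U : set T) (F : set (set T)) (Y : set T)
    : Prop :=
  Y `<=` U /\ [set Y `&` X | X in F] = [set Z | Z `<=` Y].

(* [counting Y] is the number of elements of Y, +oo if Y is infinite. The
   supremum is -oo if F is empty, as then not even set0 is shattered. *)
Definition vc_dim (R : realType) (T : choiceType) (U : set T)
    (F : set (set T)) : \bar R :=
  ereal_sup [set counting Y | Y in [set Y | shattered U F Y]].

(* A sequence s_0, ..., s_k is a function S : 'I_k.+1 -> V. *)
Definition LP_ground (R : realType) (k : nat) (M : set R)
    : set ('I_k.+1 * R) :=
  [set p : 'I_k.+1 * R | (1 <= p.1)%N /\ M p.2].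

(* If v is in a different component from both S i and S ord0, the difference
   below is +oo - +oo, which is -oo in \bar R, and (i, Delta) belongs to the
   set, in accordance with the rearranged inequality
   dist v (S i) <= dist v (S ord0) + Delta. *)
Definition LP_set (R : realType) (V : finType) (G : sgraph V)
    (w : V -> V -> R) (k : nat) (S : 'I_k.+1 -> V) (M : set R) (v : V)
    : set ('I_k.+1 * R) :=
  [set p : 'I_k.+1 * R | [/\ (1 <= p.1)%N, M p.2 &
     (dist G w v (S p.1) - dist G w v (S ord0) <= p.2%:E)%E]].

Definition LP_family (R : realType) (V : finType) (G : sgraph V)
    (w : V -> V -> R) (k : nat) (S : 'I_k.+1 -> V) (M : set R)
    : set (set ('I_k.+1 * R)) :=
  [set LP_set G w S M v | v in [set: V]].

(* Main.v *)
Require Import Defs.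
From mathcomp Require Import all_boot all_order all_algebra finmap.
From mathcomp Require Import all_classical all_reals all_analysis.
Import Order.TTheory GRing.Theory Num.Theory.
Local Open Scope classical_set_scope.
Local Open Scope ring_scope.

(** Let h points (i_j, Delta_j) be shattered and put D_j v = d(v, s_(i_j)) - Delta_j,
    so that v selects point j iff D_j v <= d(v, s_0).  The additively weighted
    Voronoi cells of the D_j, with ties broken by index, are the branch sets of a
    K_h minor.  A cell is connected because shortest paths to its site stay inside
    it.  The vertex selecting exactly j has D_j < D_c for c <> j, and this persists
    along the shortest path to site j, so that the site lies in its own cell.  At
    the vertex v selecting exactly {a, b} both D_a and D_b are below every other
    D_c, so v is in cell a or cell b, and the shortest path from v to the other
    site meets these two cells only: it contains an edge joining them. *)

(** This turns selection into a comparison of shifted distances, also at infinity: if [x] and [y]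
    are both [+oo], then [x - y] is [-oo] and both sides hold. *)
Lemma leeB_swap (R : realType) (x y : \bar R) (r : R) :
  (0 <= x)%E -> (0 <= y)%E -> (x - y <= r%:E)%E = (x - r%:E <= y)%E.
Proof.
case: x => [x| |] // _; case: y => [y| |] // _.
- by rewrite -!EFinB !lee_fin !lerBlDr addrC.
- by rewrite /= leey leNye.
- by rewrite /= leey leNye.
Qed.

(** * Shortest paths with non-negative weights *)

Section Distance.
Variables (R : realType) (V : finType) (G : sgraph V) (w : V -> V -> R).
Hypothesis w_ge0 : forall u v : V, edge G u v -> 0 <= w u v.
Local Notation d := (dist G w).
Local Notation len := (path_length w).

Lemma path_length_cons u x p : len u (x :: p) = w u x + len x p.
Proof. by rewrite /path_length /= big_cons. Qed.

Lemma path_length_ge0 u p : path (edge G) u p -> 0 <= len u p.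
Proof.
elim: p u => [|x p IHp] u /=; first by rewrite /path_length /= big_nil.
by case/andP=> ux xp; rewrite path_length_cons addr_ge0 ?w_ge0 ?IHp.
Qed.

Lemma path_length_cat_ge u p q :
  path (edge G) u (p ++ q) -> len (last u p) q <= len u (p ++ q).
Proof.
elim: p u => [|x p IHp] u //= /andP[ux xpq].
by rewrite path_length_cons ler_wpDl ?w_ge0 ?IHp.
Qed.

Lemma dist_le u p :
  path (edge G) u p -> uniq (u :: p) -> (d u (last u p) <= (len u p)%:E)%E.
Proof. by move=> up uup; apply: ereal_inf_lbound; exists p. Qed.

Lemma dist_ge0 u v : (0 <= d u v)%E.
Proof.
apply: le_ereal_inf_tmp => _ [p [up _ _] <-].
by rewrite lee_fin path_length_ge0.
Qed.

Lemma distxx u : d u u = 0%E.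
Proof.
apply/eqP; rewrite eq_le dist_ge0 andbT.
by have := @dist_le u [::]; rewrite /path_length /= big_nil; apply.
Qed.

(** Simple paths from [u] have at most [#|V|] steps, so they live in a finite type of bounded
    sequences and the infimum is attained. *)
Lemma connect_geodesic u v : connect (edge G) u v ->
  exists p, [/\ path (edge G) u p, uniq (u :: p), last u p = v &
                d u v = (len u p)%:E].
Proof.
case/connectP=> p0 up0 ->{v}; case/shortenP: up0 => p1 up1 uup1 _.
set v := last u p1.
pose P (p : #|V|.-bseq V) :=
  [&& path (edge G) u p, uniq (u :: p) & last u p == v].
have size_le p : uniq (u :: p) -> (size p <= #|V|)%N.
  by move/card_uniqP=> /= E; rewrite ltnW // -[_.+1]E max_card.
have P1 : P (Bseq (size_le _ uup1)) by rewrite /P up1 uup1 eqxx.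
case: (arg_minP (fun p : #|V|.-bseq V => len u p) P1).
move=> p /and3P[up uup /eqP upv] p_min; exists p; split=> //.
apply/eqP; rewrite eq_le -{1}upv dist_le //=.
apply: le_ereal_inf_tmp => _ [q [uq uuq uqv] <-]; rewrite lee_fin.
have := p_min (Bseq (size_le _ uuq)); apply.
by rewrite /P /= uq -/(uniq (u :: q)) uuq uqv eqxx.
Qed.

Lemma dist_lty u v : (d u v < +oo)%E = connect (edge G) u v.
Proof.
apply/idP/idP => [|/connect_geodesic[p [_ _ _ ->]]]; last exact: ltry.
apply: contraTT => uv; rewrite -leNgt.
apply: le_ereal_inf_tmp => _ [p [up _ upv] <-].
by case/negP: uv; apply/connectP; exists p.
Qed.

(** [dist] ranges over simple paths only. If the geodesic from [x] avoids [u], prepend [u];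
    otherwise its tail after [u] is simple and, weights being non-negative, no longer. *)
Lemma dist_triangle_edge u x t : edge G u x -> (d u t <= (w u x)%:E + d x t)%E.
Proof.
move=> ux; case: (boolP (connect (edge G) x t)); last first.
  by rewrite -dist_lty -leNgt leye_eq => /eqP ->; rewrite addey // leey.
case/connect_geodesic=> p [xp uxp pt ->].
have uxp_path : path (edge G) u (x :: p) by rewrite /= ux.
rewrite -EFinD -path_length_cons -pt -[last x p]/(last u (x :: p)).
case: (boolP (u \in x :: p)) => [|uNp]; last by rewrite dist_le //= uNp.
move: (x :: p) uxp uxp_path => q + + uq; case/splitPr: uq => q1 q2 uqq.
rewrite -cat_rcons => uq12.
have := uq12; rewrite cat_path last_rcons => /andP[_ uq2].
move: uqq; rewrite cat_uniq => /and3P[_ _ uuq2].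
rewrite last_cat last_rcons; apply: (le_trans (dist_le _ _ uq2 uuq2)).
by rewrite lee_fin; have := path_length_cat_ge _ _ _ uq12; rewrite last_rcons.
Qed.

(** Suffixes of a geodesic are geodesics. Taking an implication for [P] carries its hypothesis
    forward from [u] to [t]. *)
Lemma geodesic_ind t (P : V -> Prop) : P t ->
  (forall u x, edge G u x -> (d x t < +oo)%E ->
     d u t = ((w u x)%:E + d x t)%E -> P x -> P u) ->
  forall u, (d u t < +oo)%E -> P u.
Proof.
move=> Pt Pstep u; rewrite dist_lty => /connect_geodesic[p [up uup upt dp]].
elim: p u up uup upt dp => [|x p IHp] u /=; first by move=> _ _ ->.
move=> /andP[ux xp] /andP[_ uxp] xpt; rewrite path_length_cons EFinD => dp.
have dx : d x t = (len x p)%:E.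
  apply/eqP; rewrite eq_le -{1}xpt dist_le //=.
  have := dist_triangle_edge u x t ux.
  by rewrite dp leeD2lE.
by apply: (Pstep _ _ ux); [rewrite dx ltry | rewrite dp dx | exact: IHp].
Qed.

End Distance.

(** * Weighted Voronoi cells as branch sets *)

Section VoronoiMinor.
Variables (R : realType) (V : finType) (G : sgraph V) (w : V -> V -> R).
Hypothesis w_ge0 : forall u v : V, edge G u v -> 0 <= w u v.
Variables (h : nat) (site : 'I_h -> V) (shift : 'I_h -> R).
Local Notation d := (dist G w).

Definition wdist (a : 'I_h) (v : V) : \bar R := (d v (site a) - (shift a)%:E)%E.

(** On ties the smaller index wins, so of two distinct indices exactly one beats the other. *)
Definition beats (a c : 'I_h) (v : V) : bool :=
  if (c < a)%N then (wdist a v < wdist c v)%E else (wdist a v <= wdist c v)%E.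

(** Finiteness leaves out vertices that reach no site; they would otherwise fall to the least index
    and could disconnect its cell. *)
Definition voronoi (a : 'I_h) : {set V} :=
  [set v | (d v (site a) < +oo)%E && [forall c, beats a c v]].

Lemma wdist_lty a v : (wdist a v < +oo)%E = (d v (site a) < +oo)%E.
Proof. by rewrite /wdist lteBlDr. Qed.

Lemma lt_beats a c v : (wdist a v < wdist c v)%E -> beats a c v.
Proof. by rewrite /beats => ac; case: ifP => // _; exact: ltW. Qed.

Lemma beats_le a c v : beats a c v -> (wdist a v <= wdist c v)%E.
Proof. by rewrite /beats; case: ifP => // _; exact: ltW. Qed.

Lemma beatsxx a v : beats a a v.
Proof. by rewrite /beats ltnn. Qed.

Lemma beatsNC a c v : a != c -> beats a c v = ~~ beats c a v.
Proof.
rewrite /beats neq_ltn => /orP[] ac; rewrite ac ltnNge (ltnW ac) /=.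
  by rewrite -leNgt.
by rewrite -ltNge.
Qed.

Lemma voronoi_disjoint a b v : v \in voronoi a -> v \in voronoi b -> a = b.
Proof.
rewrite !inE => /andP[_ /forallP/(_ b) ab] /andP[_ /forallP/(_ a) ba].
by apply/eqP; apply/negP => /negP /(beatsNC a b v); rewrite ab ba.
Qed.

(** The step towards [site a] lowers [wdist a] by exactly [w u x], and [wdist c] by at most that
    much. *)
Lemma geodesic_step_cmp a c u x : edge G u x ->
  d u (site a) = ((w u x)%:E + d x (site a))%E ->
  ((wdist a u <= wdist c u)%E -> (wdist a x <= wdist c x)%E) /\
  ((wdist a u < wdist c u)%E -> (wdist a x < wdist c x)%E).
Proof.
move=> ux dux.
have Ea : wdist a u = ((w u x)%:E + wdist a x)%E by rewrite /wdist dux addeA.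
have Ec : (wdist c u <= (w u x)%:E + wdist c x)%E.
  by rewrite /wdist addeA leeD2rE // dist_triangle_edge.
by rewrite Ea; split => H; [have := le_trans H Ec; rewrite leeD2lE
                          |have := lt_le_trans H Ec; rewrite lteD2lE].
Qed.

Lemma geodesic_step_beats a c u x : edge G u x ->
  d u (site a) = ((w u x)%:E + d x (site a))%E -> beats a c u -> beats a c x.
Proof.
move=> ux dux; have [le_ux lt_ux] := geodesic_step_cmp a c u x ux dux.
by rewrite /beats; case: ifP.
Qed.

Lemma site_closest a c v :
  (wdist a v < wdist c v)%E -> (wdist a (site a) < wdist c (site a))%E.
Proof.
(* Being strictly below something, [wdist a v] is not [+oo], so a geodesic to [site a] exists. *)
move=> acv; have /= : (d v (site a) < +oo)%E.
  by rewrite -wdist_lty (lt_le_trans acv) // leey.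
move: v acv => v0 + dv0; move: v0 dv0.
apply: (geodesic_ind _ _ _ _ w_ge0) => // u x ux dx dux IH acu.
by apply: IH; apply: (geodesic_step_cmp a c u x ux dux).2.
Qed.

Lemma voronoi_connected a : site a \in voronoi a -> connected_in G (voronoi a).
Proof.
move=> sa; split; first by exists (site a).
set e := (X in connect X).
have e_sym : connect_sym e.
  apply: sym_connect_sym => u v.
  by rewrite /e /= (edge_sym G) andbCA.
have to_site u : u \in voronoi a -> connect e u (site a).
  move=> ua; have : (d u (site a) < +oo)%E by move: ua; rewrite inE => /andP[].
  move: u ua => u0 + du0; move: u0 du0.
  apply: (geodesic_ind _ _ _ _ w_ge0) => // u x ux dx dux IH ua.
  have xa : x \in voronoi a.
    move: ua; rewrite !inE => /andP[_ /forallP bu].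
    rewrite dx; apply/forallP=> c.
    exact: geodesic_step_beats ux dux (bu c).
  by apply: connect_trans (IH xa); apply: connect1; rewrite /e /= ua xa.
move=> x y xa ya; apply: connect_trans (to_site x xa) _.
by rewrite e_sym to_site.
Qed.

(** The winner between [a] and [b] beats every other [c]: if it is [a], then [wdist a v] is at most
    [wdist b v], hence below [wdist c v]. *)
Lemma voronoi_pair a b v : a != b -> (d v (site b) < +oo)%E ->
  (forall c, c != a -> c != b -> (wdist b v < wdist c v)%E) ->
  v \in voronoi a \/ v \in voronoi b.
Proof.
move=> ab dv bv; case: (boolP (beats b a v)) => [ba|].
  right; rewrite inE dv; apply/forallP => c.
  have [->|cb] := eqVneq c b; first exact: beatsxx.
  by have [->//|ca] := eqVneq c a; apply: lt_beats; apply: bv.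
rewrite -beatsNC // => abv; left; rewrite inE -wdist_lty.
rewrite (le_lt_trans (beats_le _ _ _ abv)) ?wdist_lty //=; apply/forallP => c.
have [->|ca] := eqVneq c a; first exact: beatsxx.
have [->//|cb] := eqVneq c b; apply: lt_beats.
exact: le_lt_trans (beats_le _ _ _ abv) (bv c ca cb).
Qed.

Lemma voronoi_crossing a b v : a != b -> site b \in voronoi b ->
  v \in voronoi a -> (d v (site b) < +oo)%E ->
  (forall c, c != a -> c != b -> (wdist b v < wdist c v)%E) ->
  exists x y, [/\ x \in voronoi a, y \in voronoi b & edge G x y].
Proof.
move=> ab sb; move: v => v0 + dv0; move: v0 dv0.
apply: (geodesic_ind _ _ _ _ w_ge0) => [sa _|u x ux dx dux IH ua bu].
  (* The geodesic cannot end in cell [a]: [site b] would then lie in two cells. *)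
  by case/eqP: ab; apply: voronoi_disjoint sa sb.
have bx c : c != a -> c != b -> (wdist b x < wdist c x)%E.
  by move=> ca cb; apply: (geodesic_step_cmp b c u x ux dux).2; apply: bu.
case: (voronoi_pair a b x ab dx bx) => xc; first exact: IH.
by exists u, x.
Qed.

Lemma voronoi_minor (s0 : V) :
  (forall A : {set 'I_h}, exists v, forall j,
     (wdist j v <= d v s0)%E = (j \in A)) ->
  is_minor (complete_graph h) G.
Proof.
move=> select.
have sites a c : c != a -> (wdist a (site a) < wdist c (site a))%E.
  move=> ca; have [v Hv] := select [set a]%SET; apply: (site_closest _ _ v).
  (* [d v s0] separates [wdist a v] from [wdist c v]. *)
  apply: (@le_lt_trans _ _ (d v s0)); first by rewrite Hv inE.
  by rewrite ltNge Hv inE.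
have site_in a : site a \in voronoi a.
  rewrite inE (distxx _ _ _ _ w_ge0) ltry; apply/forallP => c.
  have [->|ca] := eqVneq c a; first exact: beatsxx.
  exact: lt_beats (sites a c ca).
have select_out (A : {set 'I_h}) j v :
    (forall i, (wdist i v <= d v s0)%E = (i \in A)) ->
    j \notin A -> (d v s0 < +oo)%E.
  move=> Hv; rewrite -Hv -ltNge => /lt_le_trans; apply; exact: leey.
have connC : connect_sym (edge G).
  by apply: sym_connect_sym; exact: (edge_sym G).
(* At the vertex selecting only [a], the unselected [b] forces [d v s0] to be finite; [v] then links
   [site a] to [s0]. *)
have site_s0 a b : a != b -> connect (edge G) (site a) s0.
  move=> ab; have [v Hv] := select [set a]%SET.
  have v0 : (d v s0 < +oo)%E.
    by apply: select_out Hv _; rewrite inE; rewrite eq_sym in ab; exact: ab.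
  have va : (d v (site a) < +oo)%E.
    by rewrite -wdist_lty (le_lt_trans _ v0) // Hv inE.
  move: v0 va; rewrite !dist_lty // => v0 va.
  by apply: connect_trans v0; rewrite connC.
have pair a b : a != b -> exists v, [/\ (d v (site a) < +oo)%E,
    (d v (site b) < +oo)%E & forall c, c != a -> c != b ->
      (wdist a v < wdist c v)%E /\ (wdist b v < wdist c v)%E].
  move=> ab; have [v Hv] := select [set a; b]%SET.
  (* A third index stays unselected at [v], so [d v s0], and with it the distances to both sites, is
     finite. *)
  have [/existsP[c /andP[ca cb]]|/existsPn no_c] :=
      boolP [exists c, (c != a) && (c != b)].
    have v0 : (d v s0 < +oo)%E.
      by apply: (select_out _ c _ Hv); rewrite !inE negb_or ca.
    have va : (wdist a v <= d v s0)%E by rewrite Hv !inE eqxx.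
    have vb : (wdist b v <= d v s0)%E by rewrite Hv !inE eqxx orbT.
    exists v; split; rewrite -?wdist_lty ?(le_lt_trans _ v0) // => e ea eb.
    have ve : (d v s0 < wdist e v)%E by rewrite ltNge Hv !inE negb_or ea.
    by split; apply: le_lt_trans ve.
  (* A vertex selecting all of 'I_h may be unreachable from s0, so when [a] and
     [b] are the only indices, s0 itself is used. *)
  exists s0; split; rewrite ?dist_lty // 1?connC.
  - exact: site_s0 ab.
  - by rewrite eq_sym in ab; exact: site_s0 ab.
  - by move=> c ca cb; have := no_c c; rewrite ca cb.
exists voronoi; split=> [a|a b x|a b /= ab].
- exact: voronoi_connected.
- exact: voronoi_disjoint.
have [v [va vb vc]] := pair a b ab.
have ba : b != a by rewrite eq_sym.
(* From its own cell, [v] is joined by a geodesic to the site of the other cell. *)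
case: (voronoi_pair a b v ab vb) => [c ca cb|v_a|v_b].
  exact: (vc c ca cb).2.
  by apply: (voronoi_crossing a b v) => // c ca cb; exact: (vc c ca cb).2.
have [|x [y [xb ya xy]]] := voronoi_crossing b a v ba (site_in a) v_b va.
  by move=> c cb ca; exact: (vc c ca cb).1.
by exists y, x; split=> //; rewrite (edge_sym G).
Qed.

End VoronoiMinor.

(** * From shattered sets to indexed points *)

Lemma counting_gt_inj (R : realType) (T : choiceType) (Y : set T) (n : nat) :
  (n%:R%:E < counting Y :> \bar R)%E ->
  exists f : 'I_n.+1 -> T, injective f /\ forall i, Y (f i).
Proof.
move=> nY.
(* An infinite [Y] has arbitrarily large finite subsets, so [B] exists in both cases; [f] lists its
   first [n+1] elements. *)
have [B BY nB] : exists2 B : {fset T}, [set` B] `<=` Y & (n < #|` B|)%N.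
  have [Yfin|] := pselect (finite_set Y); last exact: infinite_set_fset.
  exists (fset_set Y); first by rewrite fset_setK.
  by move: nY; rewrite /counting asboolT // lte_fin ltr_nat.
have lt_B (i : 'I_n.+1) : (i < size (enum_fset B))%N.
  by apply: leq_trans (ltn_ord i) _; rewrite cardfE in nB *.
have x0 : T by case: (enum_fset B) (lt_B ord0).
exists (fun i => nth x0 (enum_fset B) i); split.
  move=> i j /eqP; rewrite nth_uniq ?lt_B ?fset_uniq // => /eqP; exact: val_inj.
by move=> i; apply: BY; rewrite /=; apply: mem_nth.
Qed.

Theorem theorem1p3 (R : realType) (h : nat) (h_ge1 : (1 <= h)%N)
  (V : finType) (G : sgraph V) (w : V -> V -> R)
  (w_sym : forall u v : V, edge G u v -> w u v = w v u)
  (w_ge0 : forall u v : V, edge G u v -> 0 <= w u v)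
  (G_Kh_free : ~ is_minor (complete_graph h) G)
  (k : nat) (S : 'I_k.+1 -> V) (M : set R) :
  (vc_dim R (@LP_ground R k M) (LP_family G w S M) <= ((h - 1)%N%:R)%:E)%E.
Proof.
apply: ge_ereal_sup => _ [Y [YU shY] <-]; rewrite leNgt; apply/negP.
rewrite subn1 => /counting_gt_inj; rewrite prednK // => -[f [f_inj fY]].
apply: G_Kh_free.
apply: (@voronoi_minor _ _ _ w w_ge0 h (fun j => S (f j).1) (fun j => (f j).2)
          (S ord0)) => A.
(* A vertex whose set cuts [Y] down to [Z] selects exactly the indices in [A], by injectivity of
   [f]. *)
pose Z := f @` [set j | j \in A].
have : [set Z | Z `<=` Y] Z by move=> _ [j _ <-]; exact: fY.
rewrite -shY => -[_ [v _ <-] XZ]; exists v => j.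
rewrite /wdist -leeB_swap ?dist_ge0 //.
have [f1 fM] := YU _ (fY j).
apply/idP/idP => [le_j|jA].
  have : Z (f j) by rewrite -XZ; split; [exact: fY | split].
  by case=> i iA /f_inj <-.
have : Z (f j) by exists j.
by rewrite -XZ => -[_ []].
Qed.
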